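(* Let $n=3$. For every $\varepsilon>0$ there is a constant $C_\varepsilon$, depending only on $\varepsilon$, such that for every finite field $F$ of characteristic $>2$ in which $-1$ is not a square, the paraboloid $$S=\{(\xi,\xi\cdot\xi):\xi\in F^{2}\}\subset F^3$$ satisfies $R^*_S(2\to \tfrac{18}{5}+\varepsilon)\le C_\varepsilon$.
   Context: $F$ is a finite field of characteristic $>2$, and $e:F\to S^1\subset\mathbb{C}$ is a fixed non-principal character, i.e. $e(x+y)=e(x)e(y)$ and $e$ is not identically $1$ (constants are uniform in the choice of $e$). $x\cdot\xi=\sum_i x_i\xi_i$ is the standard bilinear form on $F^m$ for any $m$. For a nonempty set $S\subset F^n$ of frequencies, $d\sigma$ is the normalized counting measure on $S$, so $\|g\|_{L^p(S,d\sigma)}=\left(\frac1{|S|}\sum_{\xi\in S}|g(\xi)|^p\right)^{1/p}$, and for $g:S\to\mathbb{C}$ one defines $(g\,d\sigma)^\vee(x)=\frac1{|S|}\sum_{\xi\in S}g(\xi)e(x\cdot\xi)$ for $x\in F^n$. $L^q(F^n,dx)$ is taken with respect to counting measure. For $1\le p,q\le\infty$, $R^*_S(p\to q)$ is the best (smallest) constant such that $\|(g\,d\sigma)^\vee\|_{L^q(F^n,dx)}\le R^*_S(p\to q)\,\|g\|_{L^p(S,d\sigma)}$ for all $g:S\to\mathbb{C}$. *)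

(* Defs.v *)
From HB Require Import structures.
From mathcomp Require Import all_boot all_order all_algebra.
From mathcomp Require Import all_classical all_reals ereal exp.
From mathcomp Require Import complex.

Set Implicit Arguments.
Unset Strict Implicit.
Unset Printing Implicit Defensive.

Import Order.TTheory GRing.Theory Num.Theory.

Local Open Scope ring_scope.

Definition dotp (F : finFieldType) (n : nat) (x xi : 'rV[F]_n) : F :=
  \sum_(i < n) x 0 i * xi 0 i.

Definition nonprincipal_character (R : realType) (F : finFieldType)
    (e : F -> R[i]) : Prop :=
  [/\ forall x, Normc.normc (e x) = 1,
      forall x y, e (x + y) = e x * e y
    & exists x, e x <> 1].

(* The L^p norm on the finite set A of the measure giving mass w to each point
   of A; p = +oo is the maximum over A, and p = -oo is a junk case. *)
Definition Lnorm_fin (R : realType) (T : finType) (w : R) (A : {set T})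
    (p : \bar R) (f : T -> R[i]) : R :=
  match p with
  | r%:E => (\sum_(x in A) w * Normc.normc (f x) `^ r) `^ r^-1
  | +oo%E => \big[Num.max/0]_(x in A) Normc.normc (f x)
  | -oo%E => 0
  end.

Definition Lnorm_dsigma (R : realType) (F : finFieldType) (n : nat)
    (S : {set 'rV[F]_n}) (p : \bar R) (g : 'rV[F]_n -> R[i]) : R :=
  Lnorm_fin #|S|%:R^-1 S p g.

Definition Lnorm_dx (R : realType) (F : finFieldType) (n : nat)
    (q : \bar R) (f : 'rV[F]_n -> R[i]) : R :=
  Lnorm_fin 1 [set: 'rV[F]_n] q f.

Definition extension (R : realType) (F : finFieldType) (n : nat)
    (e : F -> R[i]) (S : {set 'rV[F]_n}) (g : 'rV[F]_n -> R[i])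
    (x : 'rV[F]_n) : R[i] :=
  #|S|%:R^-1 * \sum_(xi in S) g xi * e (dotp x xi).

(* Functions g : S -> C are represented by functions on all of F^n: only their
   values on S enter either side of the inequality. *)
Definition Rstar (R : realType) (F : finFieldType) (n : nat) (e : F -> R[i])
    (S : {set 'rV[F]_n}) (p q : \bar R) : \bar R :=
  ereal_inf [set C%:E | C in [set C : R | forall g : 'rV[F]_n -> R[i],
    Lnorm_dx q (extension e S g) <= C * Lnorm_dsigma S p g]]%classic.

Definition paraboloid (F : finFieldType) (d : nat) : {set 'rV[F]_(d + 1)} :=
  [set row_mx xi (const_mx (dotp xi xi)) | xi : 'rV[F]_d].

(* Main.v *)
Require Import Defs.
From HB Require Import structures.
From mathcomp Require Import all_boot all_order all_algebra.
From mathcomp Require Import all_classical all_reals ereal exp.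
From mathcomp Require Import complex.
From mathcomp Require Import zify ring.

Set Implicit Arguments.
Unset Strict Implicit.
Unset Printing Implicit Defensive.

Import Order.TTheory GRing.Theory Num.Theory.

Local Open Scope ring_scope.

(** By duality, bounding the extension operator from L^2(S) on a level set E
    amounts to bounding in L^2(S) the Fourier transform of a function th with
    |th| <= 1 supported on E. Write q = |F|, N = |E|, and let T be the square of
    that norm. The goal is T^9 <= C N^13; if u is the modulus of the extension
    of g and E = {u > l}, it gives l^18 N^5 <= C ||g||_2^18, which is the weak
    endpoint estimate L^2 -> L^(18/5). Summing over dyadic levels l, the loss of
    eps in the exponent makes the sum a convergent geometric series
    ([strong_of_weak]).

    Expanding T gives a double sum over x, y in E of the Fourier transform of
    the surface measure at x - y. Cut E by the horizontal planes, the slices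
    E_z. Pairs in a common slice contribute at most N to T, by
    orthogonality. For pairs in different slices the kernel is a Gauss sum; its
    size 1/q gives at once that this contribution I is at most N^2 / q
    ([interaction_le_card]). Completing the square also shows that, for fixed z,
    the sum over x in E_z has q^(-1) times the modulus of an exponential sum over
    the points (a, a.a), a in E_z, at a frequency that determines y
    (the pseudo-conformal symmetry, [gauss_kernel] and [pseudoconformal_inj]).
    Hölder then leads to the L^4 norm of an exponential sum on the paraboloid,
    i.e. to the additive energy of the lifted slice
    ([sum_exp4_le_energy]).

    An additive quadruple on the paraboloid projects to a rectangle in the
    plane. As -1 is not a square, no nonzero vector is orthogonal to itself, so
    that for fixed a the lines through c orthogonal to c - a are distinct as c
    varies, and two of them meet at most once. The Cauchy-Schwarz incidence
    bound gives at most O(m^(5/2)) rectangles in a set of m points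
    ([energy_sqr]). Adding up the slices by concavity,
    I^8 <= C N^11 q. Multiplying the ninth power of this by the ninth power of
    I <= N^2 / q makes q disappear: I^81 <= C^9 N^117, that is
    I^9 <= C N^13. *)

(** * Cauchy-Schwarz and additive energy *)

(** Twice the difference of the two sides is the sum over i, j of the squares of
    a_i b_j - a_j b_i. *)
Lemma cauchy_schwarz_sum (R : realDomainType) (I : finType) (P : pred I)
    (a b : I -> R) :
  (\sum_(i | P i) a i * b i) ^+ 2
    <= (\sum_(i | P i) a i ^+ 2) * (\sum_(i | P i) b i ^+ 2).
Proof.
rewrite -(ler_pMn2r (n := 2)) // mulr2n.
rewrite expr2 !big_distrlr /= [X in _ <= X]mulr2n.
rewrite [X in _ <= _ + X]exchange_big /= -!big_split /=.
apply: ler_sum => i _; rewrite -!big_split /=.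
apply: ler_sum => j _; rewrite -subr_ge0.
by have := sqr_ge0 (a i * b j - a j * b i); congr (0 <= _); ring.
Qed.

Lemma sqr_sum_le_card (R : realDomainType) (I : finType) (A : {pred I})
    (f : I -> R) :
  (\sum_(i in A) f i) ^+ 2 <= #|A|%:R * \sum_(i in A) f i ^+ 2.
Proof.
have := cauchy_schwarz_sum (mem A) (fun=> 1) f.
under eq_bigr do rewrite mul1r.
by under [X in _ <= X * _ -> _]eq_bigr do rewrite expr1n;
   rewrite sumr_const.
Qed.

Lemma sqr_sum_le_card_nat (I : finType) (A : {pred I}) (f : I -> nat) :
  ((\sum_(i in A) f i) ^ 2 <= #|A| * \sum_(i in A) f i ^ 2)%N.
Proof.
rewrite -(ler_nat int) natrX natrM !raddf_sum /=.
under [X in _ <= _ * X]eq_bigr do rewrite natrX.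
exact: sqr_sum_le_card.
Qed.

Lemma big_setX_pair (T : Type) (idx : T) (op : Monoid.com_law idx)
    (I J : finType) (A : {set I}) (B : {set J}) (f : I * J -> T) :
  \big[op/idx]_(p in finset.setX A B) f p
    = \big[op/idx]_(i in A) \big[op/idx]_(j in B) f (i, j).
Proof. by rewrite pair_big; apply: eq_big => -[i j] //=; rewrite finset.in_setX. Qed.

(** The second moment of the fibres of f on A: it counts ordered pairs, the
    diagonal included. *)
Definition collisions (I : finType) (T : eqType) (A : {set I}) (f : I -> T)
    : nat :=
  \sum_(i in A) \sum_(j in A) (f i == f j).

Definition additive_energy (I : finType) (V : zmodType) (A : {set I})
    (f : I -> V) : nat :=
  collisions (finset.setX A A) (fun p => f p.1 + f p.2).

Definition lift_paraboloid (F : finFieldType) (d : nat) (xi : 'rV[F]_d)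
    : 'rV[F]_(d + 1) :=
  row_mx xi (const_mx (dotp xi xi)).

(** Counts triangles with a right angle at c and one further corner at the
    fixed point a. Degenerate ones, with c = a or c = b, are included; they
    number O(#|A|) for each a. *)
Definition right_angles (F : finFieldType) (d : nat) (A : {set 'rV[F]_d})
    (a : 'rV[F]_d) : nat :=
  \sum_(c in A) \sum_(b in A) (dotp (c - a) (c - b) == 0%R).

(** * The standard bilinear form *)

Section Dot.
Variables (F : finFieldType) (n : nat).
Implicit Types x y z : 'rV[F]_n.

Lemma dotpC x y : dotp x y = dotp y x.
Proof. by apply: eq_bigr => i _; rewrite mulrC. Qed.

Lemma dotpDl x y z : dotp (x + y) z = dotp x z + dotp y z.
Proof. by rewrite -big_split; apply: eq_bigr => i _; rewrite mxE mulrDl. Qed.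

Lemma dotpDr x y z : dotp z (x + y) = dotp z x + dotp z y.
Proof. by rewrite !(dotpC z) dotpDl. Qed.

Lemma dotpZl a x y : dotp (a *: x) y = a * dotp x y.
Proof. by rewrite mulr_sumr; apply: eq_bigr => i _; rewrite mxE mulrA. Qed.

Lemma dotpZr a x y : dotp x (a *: y) = a * dotp x y.
Proof. by rewrite !(dotpC x) dotpZl. Qed.

Lemma dotpNl x y : dotp (- x) y = - dotp x y.
Proof. by rewrite -scaleN1r dotpZl mulN1r. Qed.

Lemma dotpNr x y : dotp x (- y) = - dotp x y.
Proof. by rewrite !(dotpC x) dotpNl. Qed.

Lemma dotp0l x : dotp 0 x = 0.
Proof. by rewrite -(scale0r 0) dotpZl mul0r. Qed.

Lemma dotp0r x : dotp x 0 = 0.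
Proof. by rewrite dotpC dotp0l. Qed.

Definition dotpE := (dotpDl, dotpDr, dotpNl, dotpNr, dotpZl, dotpZr).

Lemma dotp_delta x j : dotp x (delta_mx 0 j) = x 0 j.
Proof.
rewrite /dotp (bigD1 j) //= mxE !eqxx mulr1 big1 ?addr0 // => i ij.
by rewrite mxE (negPf ij) andbF mulr0.
Qed.

End Dot.

Lemma dotp_row_mx (F : finFieldType) (m n : nat) (x x' : 'rV[F]_m)
    (y y' : 'rV[F]_n) :
  dotp (row_mx x y) (row_mx x' y') = dotp x x' + dotp y y'.
Proof.
rewrite /dotp big_split_ord /=; congr (_ + _); apply: eq_bigr => i _.
  by rewrite !row_mxEl.
by rewrite !row_mxEr.
Qed.

Lemma dotp_const1 (F : finFieldType) (s t : F) :
  dotp (const_mx s : 'rV[F]_1) (const_mx t) = s * t.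
Proof. by rewrite /dotp big_ord1 !mxE. Qed.

(** In the plane this is the only form in which the hypothesis that -1 is not a
    square enters. *)
Definition anisotropic (F : finFieldType) (d : nat) : Prop :=
  forall u : 'rV[F]_d, dotp u u = 0 -> u = 0.

Lemma anisotropic2 (F : finFieldType) :
  ~ (exists x : F, x ^+ 2 = -1) -> anisotropic F 2.
Proof.
move=> nsq u; rewrite /dotp !big_ord_recl big_ord0 addr0.
set a := u 0 ord0; set b := u 0 _ => uu0.
have b0 : b = 0.
  apply/eqP/negP => /negP b0; apply: nsq; exists (a / b).
  rewrite expr_div_n expr2; apply: (canLR (mulfK _)); first by rewrite expf_neq0.
  by move/eqP: uu0; rewrite addr_eq0 => /eqP ->; rewrite mulN1r expr2.
have a0 : a = 0.
  by move/eqP: uu0; rewrite b0 mulr0 addr0 mulf_eq0 orbb => /eqP.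
apply/rowP => i; rewrite mxE; case: i => [[|[|//]] Hi].
  by rewrite -[RHS]a0; congr (u 0 _); apply: val_inj.
by rewrite -[RHS]b0; congr (u 0 _); apply: val_inj.
Qed.

(** * Rectangles in an anisotropic plane *)

Section Energy.
Variable F : finFieldType.
Hypothesis aniso : anisotropic F 2.
Implicit Types (A : {set 'rV[F]_2}) (a b c : 'rV[F]_2).

Lemma dotp2 (x y : 'rV[F]_2) : dotp x y = x 0 0 * y 0 0 + x 0 1 * y 0 1.
Proof.
rewrite /dotp !big_ord_recl big_ord0 addr0.
by have -> : lift ord0 ord0 = 1 :> 'I_2 by apply: val_inj.
Qed.

Lemma dotp_eq0 (u : 'rV[F]_2) : (dotp u u == 0) = (u == 0).
Proof.
by apply/eqP/eqP => [/aniso //|->]; rewrite dotp0l.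
Qed.

(** In characteristic 2 the vector (1, 1) would be orthogonal to itself. *)
Lemma two_neq0 : (2 : F) != 0.
Proof.
apply/eqP => two0.
have /aniso/rowP/(_ 0) : dotp (const_mx 1 : 'rV[F]_2) (const_mx 1) = 0.
  by rewrite dotp2 !mxE mul1r -two0.
by rewrite !mxE => /eqP; rewrite oner_eq0.
Qed.

Lemma dotp_sqrB (u v : 'rV[F]_2) :
  dotp (u - v) (u - v) = dotp u u - 2 * dotp u v + dotp v v.
Proof. by rewrite !dotpE (dotpC v u); ring. Qed.

(** The lines through c orthogonal to c - a and through c' orthogonal to c' - a
    share the two points b, b' only if they coincide; then c and c' are both the
    foot of the perpendicular from a to that line. In formulas: u = c - a and
    v = c' - a are orthogonal to b - b', hence parallel; with w = b - a the
    relations u.u = u.w and v.v = v.w turn this into u.v = u.u = v.v, so u - v is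
    orthogonal to itself. *)
Lemma right_angle_apex_unique a b b' c c' :
  c != a -> c' != a -> b != b' ->
  dotp (c - a) (c - b) = 0 -> dotp (c - a) (c - b') = 0 ->
  dotp (c' - a) (c' - b) = 0 -> dotp (c' - a) (c' - b') = 0 -> c = c'.
Proof.
move=> ca c'a bb' r1 r2 r3 r4.
pose u := c - a; pose v := c' - a; pose w := b - a; pose h := b - b'.
have uw : dotp u u = dotp u w.
  apply/eqP; rewrite -subr_eq0 -dotpNr -dotpDr -r1 /u /w; apply/eqP.
  by congr (dotp _ _); rewrite opprB addrA subrK.
have vw : dotp v v = dotp v w.
  apply/eqP; rewrite -subr_eq0 -dotpNr -dotpDr -r3 /v /w; apply/eqP.
  by congr (dotp _ _); rewrite opprB addrA subrK.
have uh : dotp u h = 0.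
  rewrite (_ : h = (c - b') - (c - b)); last by rewrite opprB addrC addrA subrK.
  by rewrite dotpDr dotpNr r1 r2 subr0.
have vh : dotp v h = 0.
  rewrite (_ : h = (c' - b') - (c' - b)); last first.
    by rewrite opprB addrC addrA subrK.
  by rewrite dotpDr dotpNr r3 r4 subr0.
have hn0 : dotp h h != 0 by rewrite dotp_eq0 subr_eq0.
have un0 : dotp u u != 0 by rewrite dotp_eq0 subr_eq0.
have vn0 : dotp v v != 0 by rewrite dotp_eq0 subr_eq0.
(* Both u and v are orthogonal to h, so they are parallel. *)
have D0 : u 0 0 * v 0 1 - u 0 1 * v 0 0 = 0.
  apply: (mulIf hn0); rewrite mul0r; move: uh vh; rewrite !dotp2 => uh vh.
  transitivity ((u 0 0 * h 0 0 + u 0 1 * h 0 1) * (h 0 0 * v 0 1 - h 0 1 * v 0 0)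
    + (v 0 0 * h 0 0 + v 0 1 * h 0 1) * (u 0 0 * h 0 1 - u 0 1 * h 0 0)).
    by ring.
  by rewrite uh vh !mul0r addr0.
have par x : dotp u u * dotp v x = dotp v v * dotp u x.
  apply/eqP; rewrite -subr_eq0 uw vw; apply/eqP.
  transitivity ((u 0 0 * v 0 1 - u 0 1 * v 0 0) * (w 0 0 * x 0 1 - w 0 1 * x 0 0)).
    by rewrite !dotp2; ring.
  by rewrite D0 mul0r.
have uv : dotp u v = dotp v v.
  by apply: (mulfI un0); rewrite (dotpC u) par mulrC.
have vu : dotp u v = dotp u u.
  by apply: (mulfI vn0); rewrite -par mulrC.
have : dotp (u - v) (u - v) == 0.
  by rewrite dotp_sqrB uv -vu uv; apply/eqP; ring.
by rewrite dotp_eq0 /u /v opprB addrA subrK subr_eq0 => /eqP.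
Qed.


(** Incidence bound for the |A| points b and the |A| lines through c orthogonal
    to c - a: the square of the number J of incidences is at most |A| times the
    number of pairs of lines with a marked common point, and two distinct lines
    have at most one. Hence J^2 <= |A| (|A|^2 + J). *)
Lemma right_angles_sqr A a :
  ((right_angles A a) ^ 2 <= 10 * #|A| ^ 3)%N.
Proof.
pose ra c b := dotp (c - a) (c - b) == 0.
pose J := (\sum_(b in A) \sum_(c in A | c != a) ra c b)%N.
have JA : (right_angles A a <= J + #|A|)%N.
  rewrite /right_angles /J exchange_big /= -[#|A|]sum1_card -big_split /=.
  apply: leq_sum => b bA; rewrite [X in (_ <= X + _)%N]big_mkcondr /=.
  (* Only c = a is missing from J, and it adds at most 1 for each b. *)
  case aA : (a \in A); last first.
    apply: leq_trans (leq_addr _ _); apply: leq_sum => c cA.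
    by case: (c =P a) cA => [->|_ _ //]; rewrite aA.
  rewrite (bigD1 a) //= [X in (_ <= X + _)%N](bigD1 a) //= eqxx add0n addnC.
  apply: leq_add; last by case: (_ == _).
  by apply: leq_sum => c /andP[_ ->].
have JJ : (J ^ 2 <= #|A| * (#|A| ^ 2 + J))%N.
  apply: leq_trans (sqr_sum_le_card_nat _ _) _.
  rewrite leq_mul2l; apply/orP; right.
  have -> : (#|A| ^ 2 = \sum_(c in A) \sum_(c' in A) 1)%N.
    by rewrite sum1_card sum_nat_const expnS expn1.
  under eq_bigr => b _.
    rewrite expnS expn1 big_distrlr /=; over.
  rewrite exchange_big /= {1}/J [X in (_ <= _ + X)%N]exchange_big /=.
  apply: (@leq_trans (\sum_(c in A | c != a)
     (\sum_(c' in A) 1 + \sum_(b in A) ra c b))%N); last first.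
    rewrite big_split /= leq_add2r [X in (X <= _)%N]big_mkcondr /=.
    by apply: leq_sum => c _; case: ifP.
  apply: leq_sum => c /andP[cA ca]; rewrite exchange_big /=.
  rewrite (bigD1 c) /=; last by rewrite cA.
  rewrite addnC; apply: leq_add; last first.
    by apply: leq_sum => b _; case: (ra c b).
  apply: (@leq_trans (\sum_(c' in A | (c' != a) && (c' != c)) 1)%N); last first.
    rewrite [X in (X <= _)%N]big_mkcondr /=.
    by apply: leq_sum => c' _; case: ifP.
  under [X in (_ <= X)%N]eq_bigl do rewrite andbA.
  apply: leq_sum => c' /andP[/andP[c'A c'a] c'c].
  case: (pickP [pred b in A | ra c b && ra c' b]) => [b0|no]; last first.
    rewrite big1 // => b bA; move: (no b); rewrite /= bA /=.
    by rewrite mulnb => ->.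
  move=> /= /andP[b0A /andP[/eqP r1 /eqP r2]].
  rewrite (bigD1 b0) //= big1 ?addn0; first by case: (ra _ _); case: (ra _ _).
  move=> b /andP[bA bb0]; rewrite mulnb.
  case: (boolP (ra c b && ra c' b)) => // /andP[/eqP r3 /eqP r4].
  by case/eqP: c'c; apply: (right_angle_apex_unique _ _ bb0 r4 r2 r3 r1).
(* If J <= 2 |A| this is clear; otherwise J |A| is absorbed by J^2. *)
have J4 : (J ^ 2 <= 4 * #|A| ^ 3)%N.
  move: JJ; move: (J) (#|A|) => j k; rewrite !expnS expn0 !muln1 => H.
  have [jk|kj] := leqP j (2 * k).
    have : (j * j <= 4 * (k * k))%N by nia.
    have : (k * k <= k * (k * k))%N by case: (k) => // n; rewrite leq_pmull.
    lia.
  have : (2 * (k * j) <= j * j)%N by nia.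
  by move: H; rewrite mulnDr; lia.
apply: (@leq_trans ((J + #|A|) ^ 2)); first by rewrite leq_sqr.
apply: (@leq_trans (2 * J ^ 2 + 2 * #|A| ^ 2)).
  have := nat_Cauchy J #|A|; rewrite sqrnD.
  move: (J ^ 2)%N (#|A| ^ 2)%N (J * #|A|)%N => x y z [+ _]; lia.
suff : (#|A| ^ 2 <= #|A| ^ 3)%N.
  by move: J4; move: (J ^ 2)%N (#|A| ^ 2)%N (#|A| ^ 3)%N => x y z; lia.
by rewrite [X in (_ <= X)%N]expnS; case: #|A| => // n; rewrite leq_pmull.
Qed.

(** If a + b = c + d, then a.a + b.b = c.c + d.d says that
    2 (c - a).(c - b) = 0: the quadruple is a rectangle with diagonal ab, and d is
    determined by the other three corners. *)
Lemma energy_le_right_angles A :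
  (additive_energy A (@lift_paraboloid F 2)
    <= \sum_(a in A) right_angles A a)%N.
Proof.
rewrite /additive_energy /collisions /right_angles.
rewrite big_setX_pair /=; apply: leq_sum => a aA.
rewrite [X in (_ <= X)%N]exchange_big /=; apply: leq_sum => b bA.
rewrite big_setX_pair /=; apply: leq_sum => c cA.
case: (boolP (dotp (c - a) (c - b) == 0)) => [|nra]; last first.
  rewrite big1 // => d dA; apply/eqP; rewrite eqb0; apply: contra nra.
  move/eqP; rewrite /lift_paraboloid !add_row_mx => /eq_row_mx[abcd].
  move/matrixP/(_ 0 0); rewrite !mxE => e2.
  have dE : d = a + b - c by rewrite abcd addrC addKr.
  suff : 2 * dotp (c - a) (c - b) == 0 by rewrite mulf_eq0 (negPf two_neq0).
  apply/eqP; transitivity (dotp c c + dotp d d - (dotp a a + dotp b b)).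
    by rewrite dE !dotpE (dotpC b a) (dotpC c a) (dotpC c b); ring.
  by rewrite e2 subrr.
have [dA|dA] := boolP (a + b - c \in A); last first.
  rewrite big1 // => d dA'; apply/eqP; rewrite eqb0; apply: contra dA.
  move/eqP; rewrite /lift_paraboloid !add_row_mx => /eq_row_mx[abcd _].
  by rewrite abcd addrC addKr.
move=> _; rewrite (bigD1 (a + b - c)) //= big1 ?addn0; first by case: (_ == _).
move=> d /andP[_ dn]; apply/eqP; rewrite eqb0; apply: contra dn.
move/eqP; rewrite /lift_paraboloid !add_row_mx => /eq_row_mx[abcd _].
by rewrite abcd addrC addKr.
Qed.

Lemma energy_sqr A :
  ((additive_energy A (@lift_paraboloid F 2)) ^ 2 <= 10 * #|A| ^ 5)%N.
Proof.
apply: (@leq_trans ((\sum_(a in A) right_angles A a) ^ 2)).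
  by rewrite leq_sqr energy_le_right_angles.
apply: leq_trans (sqr_sum_le_card_nat _ _) _.
apply: (@leq_trans (#|A| * \sum_(a in A) (10 * #|A| ^ 3))).
  by rewrite leq_mul2l leq_sum ?orbT // => a _; apply: right_angles_sqr.
by rewrite sum_nat_const !expnS expn0; lia.
Qed.
End Energy.

(** * Characters and Gauss sums *)

Section ComplexModulus.
Variable R : realType.
Implicit Types z : R[i].
Local Notation normc := Normc.normc.

Lemma normc_ge0 z : 0 <= normc z.
Proof. by case: z => a b; apply: sqrtr_ge0. Qed.

Lemma normc_real (x : R) : normc (real_complex R x) = `|x|.
Proof. by rewrite /= expr0n addr0 sqrtr_sqr. Qed.

Lemma sqr_normc z : real_complex R (normc z ^+ 2) = z * conjc z.
Proof.
case: z => a b; rewrite /= sqr_sqrtr ?addr_ge0 ?sqr_ge0 //.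
by apply/eqP; rewrite eq_complex /=; apply/andP; split; apply/eqP; ring.
Qed.

Lemma normc_conj z : normc (conjc z) = normc z.
Proof. by case: z => a b /=; rewrite sqrrN. Qed.

Lemma normcX z n : normc (z ^+ n) = normc z ^+ n.
Proof.
elim: n => [|n IH]; first by rewrite !expr0 Normc.normc1.
by rewrite !exprS Normc.normcM IH.
Qed.

Lemma le_normc_sum (I : Type) (r : seq I) (P : pred I) (f : I -> R[i]) :
  normc (\sum_(i <- r | P i) f i) <= \sum_(i <- r | P i) normc (f i).
Proof.
elim/big_rec2: _ => [|i y z _ le]; first by rewrite Normc.normc0.
by apply: le_trans (le_normcD _ _) _; rewrite lerD2l.
Qed.

Lemma sqr_normc_sum (I : finType) (A : {pred I}) (f : I -> R[i]) :
  real_complex R (normc (\sum_(i in A) f i) ^+ 2)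
    = \sum_(i in A) \sum_(j in A) f i * conjc (f j).
Proof. by rewrite sqr_normc rmorph_sum big_distrlr. Qed.

End ComplexModulus.

Section Character.
Variables (R : realType) (F : finFieldType) (e : F -> R[i]).
Hypothesis he : nonprincipal_character e.
Local Notation normc := Normc.normc.
Local Notation q := #|F|.

Lemma char_norm x : normc (e x) = 1. Proof. by case: he. Qed.

Lemma charD x y : e (x + y) = e x * e y. Proof. by case: he. Qed.

Lemma char0 : e 0 = 1.
Proof.
have e0 : e 0 != 0.
  by apply/eqP => e0; have := char_norm 0; rewrite e0 Normc.normc0 => /eqP;
     rewrite eq_sym oner_eq0.
by apply: (mulfI e0); rewrite -charD addr0 mulr1.
Qed.

Lemma charN x : e (- x) = conjc (e x).
Proof.
have ex0 : e x != 0.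
  by apply/eqP => e0; have := char_norm x; rewrite e0 Normc.normc0 => /eqP;
     rewrite eq_sym oner_eq0.
apply: (mulfI ex0); rewrite -charD subrr char0.
by rewrite -sqr_normc char_norm expr1n.
Qed.

Lemma sum_char_dotp (n : nat) (y : 'rV[F]_n) :
  \sum_x e (dotp x y) = (q ^ n * (y == 0))%:R.
Proof.
have [->|y0] := eqVneq y 0.
  rewrite (eq_bigr (fun=> 1)) => [|x _]; last by rewrite dotp0r char0.
  by rewrite sumr_const card_mx mul1n muln1.
rewrite muln0; have [x1 ex1] : exists x, e x <> 1 by case: he.
have [j yj] : exists j, y 0 j != 0 by apply/rV0Pn.
(* Translation by x0, where dotp x0 y = x1, multiplies the sum by e x1. *)
pose x0 := (x1 / y 0 j) *: delta_mx 0 j : 'rV[F]_n.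
set s := \sum_x _.
have : s = s * e x1.
  rewrite {1}/s (reindex_inj (addIr x0)) /= mulr_suml.
  apply: eq_bigr => x _; rewrite dotpDl charD dotpZl (dotpC (delta_mx _ _)).
  by rewrite dotp_delta divfK.
move/eqP; rewrite -subr_eq0 -[X in X - _]mulr1 -mulrBr mulf_eq0.
by case/orP => [/eqP //|]; rewrite subr_eq0 eq_sym => /eqP.
Qed.

(** Expanding the square and summing over x first, orthogonality keeps exactly
    the pairs i, j with phi i = phi j. *)
Lemma dual_parseval_le (n : nat) (I : finType) (A : {set I})
    (phi : I -> 'rV[F]_n) (w : I -> R[i]) :
  (forall i, normc (w i) <= 1) ->
  \sum_x normc (\sum_(i in A) w i * e (dotp x (phi i))) ^+ 2
    <= (q ^ n * collisions A phi)%:R.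
Proof.
move=> w1; set lhs := \sum_x _.
have lhs_ge0 : 0 <= lhs by apply: sumr_ge0 => x _; rewrite exprn_ge0 ?normc_ge0.
have E : real_complex R lhs = \sum_(i in A) \sum_(j in A)
    w i * conjc (w j) * (q ^ n * (phi i == phi j))%:R.
  rewrite /lhs rmorph_sum /=.
  under eq_bigr do rewrite sqr_normc_sum.
  rewrite exchange_big /=; apply: eq_bigr => i _.
  rewrite exchange_big /=; apply: eq_bigr => j _.
  rewrite -(subr_eq0 (phi i)) -sum_char_dotp mulr_sumr; apply: eq_bigr => x _.
  by rewrite dotpDr dotpNr charD charN rmorphM /=; ring.
rewrite -(ger0_norm lhs_ge0) -normc_real E.
apply: le_trans (le_normc_sum _ _ _) _.
rewrite natrM /collisions natr_sum mulr_sumr; apply: ler_sum => i _.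
apply: le_trans (le_normc_sum _ _ _) _.
rewrite natr_sum mulr_sumr; apply: ler_sum => j _.
rewrite !Normc.normcM normc_conj natrM -!mulrA.
rewrite (_ : _%:R * _%:R = real_complex R ((q ^ n)%:R * (phi i == phi j)%:R)).
  rewrite normc_real ger0_norm ?mulr_ge0 //.
  by rewrite mulrA ler_piMl ?mulr_ge0 // mulr_ile1 ?normc_ge0.
by rewrite rmorphM /= !rmorph_nat.
Qed.

(** The fourth power is the square of the modulus of the squared sum, itself an
    exponential sum over pairs. *)
Lemma sum_exp4_le_energy (n : nat) (I : finType) (A : {set I})
    (phi : I -> 'rV[F]_n) (w : I -> R[i]) :
  (forall i, normc (w i) <= 1) ->
  \sum_x normc (\sum_(i in A) w i * e (dotp x (phi i))) ^+ 4
    <= (q ^ n * additive_energy A phi)%:R.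
Proof.
move=> w1; pose w2 (p : I * I) := w p.1 * w p.2.
have w21 p : normc (w2 p) <= 1.
  by rewrite Normc.normcM mulr_ile1 ?normc_ge0.
apply: le_trans (dual_parseval_le (finset.setX A A) (fun p => phi p.1 + phi p.2) w21).
apply: ler_sum => x _; rewrite (exprM _ 2 2) -normcX.
set s := (X in normc X); set s' := \sum_(p in _) _; suff -> : s = s' by [].
rewrite /s /s' expr2 big_distrlr big_setX_pair /=.
apply: eq_bigr => i _; apply: eq_bigr => j _.
by rewrite /w2 /= dotpDr charD; ring.
Qed.

Hypothesis two0 : (2 : F) != 0.

Definition gauss_sum (d : nat) (t : F) : R[i] :=
  \sum_(xi : 'rV[F]_d) e (t * dotp xi xi).

Lemma gauss_complete_square (d : nat) (t : F) (u : 'rV[F]_d) : t != 0 ->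
  \sum_xi e (dotp u xi + t * dotp xi xi)
    = gauss_sum d t * e (- (4 * t)^-1 * dotp u u).
Proof.
move=> t0; rewrite (reindex_inj (subIr ((2 * t)^-1 *: u))) /= mulr_suml.
apply: eq_bigr => xi _; rewrite -charD; congr e.
rewrite !dotpE (dotpC xi u).
by field; rewrite two0 t0 (_ : (4 : F) = 2 * 2) ?mulf_neq0 // -natrM.
Qed.

(** In the double sum for the square, with h the difference of the two
    variables, the quadratic terms cancel and the sum over the other variable is
    linear, so only h = 0 survives. *)
Lemma gauss_sum_norm (d : nat) (t : F) : t != 0 ->
  normc (gauss_sum d t) ^+ 2 = (q ^ d)%:R.
Proof.
move=> t0; apply: (@complexI R); rewrite sqr_normc_sum.
under eq_bigr do under eq_bigr do rewrite -charN -charD.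
rewrite exchange_big /=.
under eq_bigr => x _ do rewrite (reindex_inj (addrI x)) /=.
rewrite exchange_big /=.
transitivity (\sum_(h : 'rV[F]_d)
    e (t * dotp h h) * (q ^ d * ((2 * t) *: h == 0))%:R : R[i]).
  apply: eq_bigr => h _; rewrite -sum_char_dotp mulr_sumr.
  apply: eq_bigr => x _; rewrite -charD; congr e; rewrite !dotpE (dotpC h x).
  by ring.
rewrite (bigD1 0) //= dotp0r mulr0 char0 mul1r scaler0 eqxx muln1.
rewrite big1 ?addr0 ?rmorph_nat // => h h0.
rewrite scaler_eq0 mulf_eq0 (negPf two0) (negPf t0).
by rewrite (negPf h0) muln0 mulr0.
Qed.

End Character.

(** * Interpolation between slices *)

Section RealSums.
Variable R : realType.

Lemma eighth_root (x : R) : 0 <= x -> exists2 y, 0 <= y & y ^+ 8 = x.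
Proof.
move=> x0; exists (Num.sqrt (Num.sqrt (Num.sqrt x))); first exact: sqrtr_ge0.
by rewrite (exprM _ 2 4) (exprM _ 2 2) !sqr_sqrtr ?sqrtr_ge0.
Qed.

(** Concavity of the power 5/8. With c_i and s the eighth roots of m_i and of
    the mean N / #|I|, it takes the crude form c_i^5 s^3 <= c_i^8 + s^8, whence the
    constant 2^8. *)
Lemma sum_le_of_exp8_le (I : finType) (J m : I -> R) (B N : R) :
  0 <= B -> (forall i, 0 <= J i) -> (forall i, 0 <= m i) ->
  \sum_i m i = N -> (forall i, J i ^+ 8 <= B * m i ^+ 5) ->
  (\sum_i J i) ^+ 8 <= 2 ^+ 8 * B * #|I|%:R ^+ 3 * N ^+ 5.
Proof.
move=> B0 J0 m0 mN Jm.
have N0 : 0 <= N by rewrite -mN sumr_ge0.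
have [N00|Npos] := eqVneq N 0.
  rewrite big1 => [|i _]; first by rewrite expr0n !mulr_ge0 // exprn_ge0.
  have mi0 : m i = 0.
    exact: (psumr_eq0P (fun j _ => m0 j) (etrans mN N00)).
  have := Jm i; rewrite mi0 expr0n mulr0 => Ji8.
  have : J i ^+ 8 == 0 by rewrite eq_le Ji8 exprn_ge0.
  by rewrite expf_eq0 => /andP[_ /eqP].
have I0 : 0 < #|I|%:R :> R.
  rewrite ltr0n lt0n; apply: contra Npos => /eqP/card0_eq I0.
  by rewrite -mN big_pred0.
have [b b0 bE] := eighth_root B0.
have [s s0 sE] := eighth_root (divr_ge0 N0 (ltW I0)).
have croot i := eighth_root (m0 i).
pose c i := s2val (cid2 (croot i)).
have c0 i : 0 <= c i := s2valP (cid2 (croot i)).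
have cE i : c i ^+ 8 = m i := s2valP' (cid2 (croot i)).
have Jc i : J i <= b * c i ^+ 5.
  rewrite -(ler_pXn2r (n := 8)) ?nnegrE ?mulr_ge0 ?exprn_ge0 //.
  by rewrite exprMn bE exprAC cE.
have cs i : c i ^+ 5 * s ^+ 3 <= c i ^+ 8 + s ^+ 8.
  have [le|/ltW le] := leP (c i) s.
    apply: (@le_trans _ _ (s ^+ 8)); last by rewrite lerDr exprn_ge0.
    by rewrite (exprD s 5 3) ler_wpM2r ?exprn_ge0 // lerXn2r ?nnegrE.
  apply: (@le_trans _ _ (c i ^+ 8)); last by rewrite lerDl exprn_ge0.
  by rewrite (exprD (c i) 5 3) ler_wpM2l ?exprn_ge0 // lerXn2r ?nnegrE.
have Js : (\sum_i J i) * s ^+ 3 <= 2 * b * N.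
  apply: (@le_trans _ _ (\sum_i b * (c i ^+ 8 + s ^+ 8))).
    rewrite mulr_suml; apply: ler_sum => i _.
    apply: (@le_trans _ _ (b * (c i ^+ 5 * s ^+ 3))).
      by rewrite mulrA ler_wpM2r ?exprn_ge0.
    by rewrite ler_wpM2l.
  rewrite -mulr_sumr big_split /= (eq_bigr m) // mN sE sumr_const.
  rewrite -(mulr_natr (N / _)) divfK ?gt_eqF // le_eqVlt; apply/orP; left.
  by apply/eqP; ring.
have : ((\sum_i J i) * s ^+ 3) ^+ 8 <= (2 * b * N) ^+ 8.
  by rewrite lerXn2r ?nnegrE ?mulr_ge0 ?exprn_ge0 ?sumr_ge0.
set Jt := \sum_i J i.
have -> : (Jt * s ^+ 3) ^+ 8 = Jt ^+ 8 * (s ^+ 8) ^+ 3 by ring.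
have -> : (2 * b * N) ^+ 8 = 2 ^+ 8 * b ^+ 8 * N ^+ 8 by ring.
rewrite bE sE expr_div_n mulrA ler_pdivrMr ?exprn_gt0 // (exprD N 5 3) => H.
rewrite -(ler_pM2r (x := N ^+ 3)) ?exprn_gt0 ?lt0r ?Npos //.
by apply: le_trans H _; rewrite le_eqVlt; apply/orP; left; apply/eqP; ring.
Qed.

(** Since J^81 = J^9 (J^8)^9, multiply the ninth powers of the two hypotheses.
    These weights leave r, which stands for q^9, with the same exponent as J^9, so
    that no power of q remains in the bound for J / q. *)
Lemma exp9_le_of_exp8_le (J n k r : R) :
  0 <= J -> 0 <= n -> 0 <= k -> 0 <= r -> J <= n ^+ 2 ->
  J ^+ 8 <= k * n ^+ 11 * r -> J ^+ 9 <= k * n ^+ 13 * r.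
Proof.
move=> J0 n0 k0 r0 J2 J8.
have J9 : J ^+ 9 <= (n ^+ 2) ^+ 9.
  by rewrite lerXn2r ?nnegrE ?exprn_ge0.
have J72 : (J ^+ 8) ^+ 9 <= (k * n ^+ 11 * r) ^+ 9.
  by rewrite lerXn2r ?nnegrE ?mulr_ge0 ?exprn_ge0.
rewrite -(ler_pXn2r (n := 9)) ?nnegrE ?mulr_ge0 ?exprn_ge0 //.
have -> : (J ^+ 9) ^+ 9 = J ^+ 9 * (J ^+ 8) ^+ 9.
  by rewrite -[(J ^+ 8) ^+ 9]exprM -exprD -exprM.
have -> : (k * n ^+ 13 * r) ^+ 9 = (n ^+ 2) ^+ 9 * (k * n ^+ 11 * r) ^+ 9.
  by rewrite -exprMn; congr (_ ^+ 9); ring.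
by rewrite ler_pM // exprn_ge0 // exprn_ge0.
Qed.

Lemma exp4_sum_le_card (I : finType) (A : {pred I}) (f : I -> R) :
  (\sum_(i in A) f i) ^+ 4 <= #|A|%:R ^+ 3 * \sum_(i in A) f i ^+ 4.
Proof.
rewrite (exprM _ 2 2).
apply: (@le_trans _ _ ((#|A|%:R * \sum_(i in A) f i ^+ 2) ^+ 2)).
  rewrite lerXn2r ?nnegrE ?exprn_even_ge0 ?sqr_sum_le_card //.
  by rewrite mulr_ge0 ?sumr_ge0 // => i _; rewrite sqr_ge0.
rewrite exprMn (exprSr _ 2) -mulrA ler_wpM2l ?exprn_ge0 //.
apply: le_trans (sqr_sum_le_card _ _) _.
by under eq_bigr do rewrite -exprM.
Qed.

End RealSums.

(** * The dual restriction estimate for a set *)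

Section DualRestriction.
Variables (R : realType) (F : finFieldType) (e : F -> R[i]).
Hypothesis he : nonprincipal_character e.
Hypothesis aniso : anisotropic F 2.
Local Notation normc := Normc.normc.
Local Notation q := #|F|.
Local Notation lift := (@lift_paraboloid F 2).
Implicit Types (a b xi : 'rV[F]_2) (z t : F).

Definition point a z : 'rV[F]_(2 + 1) := row_mx a (const_mx z).

Definition slice (E : {set 'rV[F]_(2 + 1)}) z : {set 'rV[F]_2} :=
  [set a | point a z \in E].

Lemma sum_slices (V : nmodType) (E : {set 'rV[F]_(2 + 1)})
    (f : 'rV[F]_(2 + 1) -> V) :
  \sum_(x in E) f x = \sum_z \sum_(a in slice E z) f (point a z).
Proof.
rewrite pair_big_dep /=.
rewrite (reindex (fun p : F * 'rV[F]_2 => point p.2 p.1)) /=.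
  by apply: eq_bigl => -[z a]; rewrite inE.
exists (fun x => (rsubmx x 0 0, lsubmx x)) => [[z a] _|x _] /=.
  by rewrite row_mxKl row_mxKr mxE.
rewrite -[RHS]hsubmxK; congr row_mx.
by apply/rowP => i; rewrite mxE ord1.
Qed.

Lemma card_slices (E : {set 'rV[F]_(2 + 1)}) :
  (\sum_z #|slice E z|)%N = #|E|.
Proof.
rewrite -sum1_card (sum_slices E (fun=> 1%N)).
by apply: eq_bigr => z _; rewrite sum1_card.
Qed.

Lemma dotp_lift a z xi : dotp (point a z) (lift xi) = dotp a xi + z * dotp xi xi.
Proof. by rewrite dotp_row_mx dotp_const1. Qed.

(** The frequency at which the lifted slice of height z sees the point (a, t).
    Up to a phase depending on (a, t) only, exp of -|x - a|^2 / (4 (z - t)) is the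
    character of this frequency at the lift of x: this is the pseudo-conformal
    change of variables. *)
Definition pseudoconformal z a t : 'rV[F]_(2 + 1) :=
  point ((2 * (z - t))^-1 *: a) (- (4 * (z - t))^-1).

Lemma pointB a b z t : point a z - point b t = point (a - b) (z - t).
Proof.
rewrite /point opp_row_mx add_row_mx; congr row_mx.
by apply/rowP => i; rewrite !mxE.
Qed.

Lemma gauss_kernel z t a b : z != t ->
  \sum_xi e (dotp (point a z - point b t) (lift xi))
    = gauss_sum e 2 (z - t) * e (- (4 * (z - t))^-1 * dotp b b)
      * e (dotp (pseudoconformal z b t) (lift a)).
Proof.
rewrite -subr_eq0 pointB => r0; have two0 := two_neq0 aniso.
under eq_bigr do rewrite dotp_lift.
rewrite (gauss_complete_square he two0) // -mulrA -(charD he).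
congr (_ * e _); rewrite dotp_lift dotpZl dotp_sqrB (dotpC b a).
by field; rewrite two0 r0 (_ : (4 : F) = 2 * 2) ?mulf_neq0 // -natrM.
Qed.

Lemma diagonal_kernel z a b :
  \sum_xi e (dotp (point a z - point b z) (lift xi))
    = (q ^ 2 * (a == b))%:R.
Proof.
rewrite pointB subrr -subr_eq0 -(sum_char_dotp he).
by apply: eq_bigr => xi _; rewrite dotp_lift mul0r addr0 dotpC.
Qed.

(** The last coordinate recovers z - t, and then the others recover a. *)
Lemma pseudoconformal_inj z :
  {in [set p : F * 'rV[F]_2 | p.1 != z] &,
    injective (fun p => pseudoconformal z p.2 p.1)}.
Proof.
have two0 := two_neq0 aniso.
have four0 : (4 : F) != 0 by rewrite (_ : (4 : F) = 2 * 2) ?mulf_neq0 // -natrM.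
move=> [t a] [s b]; rewrite !inE /= => tz sz /eq_row_mx[eqa].
move/rowP/(_ 0); rewrite !mxE => /oppr_inj/invr_inj/(mulfI four0)/addrI/oppr_inj ts.
move: eqa; rewrite ts => /scalerI ->; rewrite //.
by rewrite invr_neq0 // mulf_neq0 // subr_eq0 eq_sym.
Qed.

Variables (E : {set 'rV[F]_(2 + 1)}) (th : 'rV[F]_(2 + 1) -> R[i]).
Hypothesis th1 : forall x, normc (th x) <= 1.
Local Notation N := #|E|.

Definition slice_sum z (w : 'rV[F]_(2 + 1)) : R :=
  normc (\sum_(a in slice E z) th (point a z) * e (dotp w (lift a))).

(** Up to a factor q, this bounds the contribution of the pairs of one point of
    height z and one point of any other height. *)
Definition interaction z : R :=
  \sum_(t | t != z) \sum_(b in slice E t) slice_sum z (pseudoconformal z b t).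

Lemma slice_sum_ge0 z w : 0 <= slice_sum z w.
Proof. exact: normc_ge0. Qed.

Lemma slice_sum_le z w : slice_sum z w <= #|slice E z|%:R.
Proof.
apply: le_trans (le_normc_sum _ _ _) _.
rewrite -sum1_card natr_sum; apply: ler_sum => a _.
by rewrite Normc.normcM (char_norm he) mulr1.
Qed.

Lemma interaction_ge0 z : 0 <= interaction z.
Proof. by do 2![apply: sumr_ge0 => ? _]; apply: slice_sum_ge0. Qed.

(** Pairs of equal height contribute by orthogonality only when they coincide,
    the others through a Gauss sum of modulus q. *)
Lemma dual_sqr_le_interaction :
  \sum_xi normc (\sum_(x in E) th x * e (dotp x (lift xi))) ^+ 2
    <= q%:R ^+ 2 * N%:R + q%:R * \sum_z interaction z.
Proof.
have two0 := two_neq0 aniso.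
pose ker x y := \sum_xi e (dotp (x - y) (lift xi)).
set lhs := \sum_xi _.
have lhs_ge0 : 0 <= lhs by apply: sumr_ge0 => x _; rewrite exprn_ge0 ?normc_ge0.
have lhsE : real_complex R lhs =
    \sum_(y in E) conjc (th y) * \sum_(x in E) th x * ker x y.
  rewrite /lhs rmorph_sum /=.
  under eq_bigr do rewrite sqr_normc_sum exchange_big /=.
  rewrite exchange_big /=; apply: eq_bigr => y _.
  rewrite exchange_big mulr_sumr /=; apply: eq_bigr => x _.
  rewrite /ker !mulr_sumr; apply: eq_bigr => xi _.
  by rewrite dotpDl dotpNl (charD he) (charN he) rmorphM /=; ring.
have diag t b : normc (\sum_(a in slice E t) th (point a t)
    * ker (point a t) (point b t)) <= q%:R ^+ 2.
  apply: le_trans (le_normc_sum _ _ _) _.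
  apply: (@le_trans _ _ (\sum_(a : 'rV[F]_2) (q ^ 2 * (a == b))%:R)).
    rewrite big_mkcond /=; apply: ler_sum => a _; case: ifP => // _.
    rewrite /ker diagonal_kernel Normc.normcM -(rmorph_nat (real_complex R)).
    by rewrite normc_real normr_nat ler_piMl.
  rewrite (bigD1 b) //= eqxx muln1 big1 ?addr0 ?natrX // => a /negPf ->.
  by rewrite muln0.
have off t b z : z != t -> normc (\sum_(a in slice E z) th (point a z)
    * ker (point a z) (point b t)) = q%:R * slice_sum z (pseudoconformal z b t).
  move=> zt; rewrite /slice_sum.
  transitivity (normc (gauss_sum e 2 (z - t)
      * e (- (4 * (z - t))^-1 * dotp b b)
      * \sum_(a in slice E z)
          th (point a z) * e (dotp (pseudoconformal z b t) (lift a)))).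
    congr normc; rewrite mulr_sumr; apply: eq_bigr => a _.
    by rewrite /ker gauss_kernel //; ring.
  rewrite !Normc.normcM (char_norm he) mulr1; congr (_ * _).
  apply/eqP; rewrite -(eqrXn2 (n := 2)) ?normc_ge0 //.
  by rewrite (gauss_sum_norm he two0) ?subr_eq0 // natrX.
rewrite -(ger0_norm lhs_ge0) -normc_real lhsE.
apply: le_trans (le_normc_sum _ _ _) _.
have row t b : normc (conjc (th (point b t))
    * \sum_(x in E) th x * ker x (point b t))
    <= q%:R ^+ 2 + q%:R * \sum_(z | t != z) slice_sum z (pseudoconformal z b t).
  rewrite Normc.normcM normc_conj; apply: (@le_trans _ _
    (normc (\sum_(x in E) th x * ker x (point b t)))).
    by rewrite ler_piMl ?normc_ge0.
  rewrite sum_slices (bigD1 t) //=.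
  apply: le_trans (le_normcD _ _) _; rewrite lerD ?diag //.
  apply: le_trans (le_normc_sum _ _ _) _; rewrite mulr_sumr le_eqVlt.
  apply/orP; left; apply/eqP; apply: eq_big => z; first by rewrite eq_sym.
  exact: off.
have -> : \sum_z interaction z = \sum_t \sum_(b in slice E t)
    \sum_(z | t != z) slice_sum z (pseudoconformal z b t).
  rewrite /interaction (exchange_big_dep xpredT) //=; apply: eq_bigr => t _.
  by rewrite exchange_big.
rewrite -card_slices natr_sum sum_slices !mulr_sumr -big_split /=.
apply: ler_sum => t _.
rewrite -[#|slice E t|]sum1_card natr_sum !mulr_sumr -big_split /=.
by apply: ler_sum => b _; rewrite mulr1 row.
Qed.

(** The trivial bound of each sum over a slice by its number of terms. *)
Lemma interaction_le_card : \sum_z interaction z <= N%:R ^+ 2.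
Proof.
apply: (@le_trans _ _ (\sum_z \sum_t \sum_(b in slice E t) #|slice E z|%:R)).
  apply: ler_sum => z _; rewrite /interaction big_mkcond /=; apply: ler_sum => t _.
  case: ifP => _; last by apply: sumr_ge0.
  by apply: ler_sum => b _; apply: slice_sum_le.
rewrite le_eqVlt; apply/orP; left; apply/eqP.
rewrite expr2 -{1}card_slices natr_sum mulr_suml; apply: eq_bigr => z _.
rewrite -card_slices natr_sum mulr_sumr; apply: eq_bigr => t _.
by rewrite sumr_const mulr_natr.
Qed.

(** Hölder from L^1 to L^4 over the points of E off the plane of height z; by
    injectivity of the frequencies the fourth powers sum to at most the full L^4
    norm, which the additive energy of the slice controls. *)
Lemma interaction_exp8_le z :
  interaction z ^+ 8 <= 10 * N%:R ^+ 6 * q%:R ^+ 6 * #|slice E z|%:R ^+ 5.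
Proof.
pose A := [set p : F * 'rV[F]_2 | (p.1 != z) && (p.2 \in slice E p.1)]%SET.
pose f p := slice_sum z (pseudoconformal z p.2 p.1).
have AN : (#|A| <= N)%N.
  rewrite -card_slices -sum1_card.
  under [X in (_ <= X)%N]eq_bigr do rewrite -sum1_card.
  rewrite pair_big_dep /= big_mkcond /= [X in (_ <= X)%N]big_mkcond /=.
  apply: leq_sum => -[t b] _; rewrite !inE /=.
  by case: (_ != _) => //; case: ifP.
have interactionE : interaction z = \sum_(p in A) f p.
  rewrite /interaction pair_big_dep /=; apply: eq_bigl => -[t b].
  by rewrite !inE.
have f4 : \sum_(p in A) f p ^+ 4
    <= (q ^ 3 * additive_energy (slice E z) lift)%:R.
  apply: le_trans (sum_exp4_le_energy he (slice E z) lift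
    (fun a => th1 (point a z))).
  rewrite -(big_imset (fun w => slice_sum z w ^+ 4)
    (h := fun p => pseudoconformal z p.2 p.1)) /=; last first.
    move=> p r; rewrite !inE => /andP[pz _] /andP[rz _].
    by apply: pseudoconformal_inj; rewrite inE.
  rewrite big_mkcond /=; apply: ler_sum => w _; case: ifP => // _.
  by rewrite exprn_ge0 ?normc_ge0.
rewrite (exprM _ 4 2) interactionE.
apply: (@le_trans _ _ ((N%:R ^+ 3
    * (q ^ 3 * additive_energy (slice E z) lift)%:R) ^+ 2)).
  rewrite lerXn2r ?nnegrE ?exprn_ge0 ?mulr_ge0 ?sumr_ge0 // => [p _|].
    exact: slice_sum_ge0.
  apply: le_trans (exp4_sum_le_card _ _) _.
  rewrite ler_pM ?exprn_ge0 ?sumr_ge0 // => [p _|].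
    by rewrite exprn_ge0 ?slice_sum_ge0.
  by rewrite lerXn2r ?nnegrE // ler_nat.
rewrite -!natrX -!natrM -natrX ler_nat.
have := energy_sqr aniso (slice E z).
move: (additive_energy _ _) => W W2.
have -> : ((N ^ 3 * (q ^ 3 * W)) ^ 2 = N ^ 6 * q ^ 6 * W ^ 2)%N.
  by ring.
apply: leq_trans (leq_mul (leqnn _) W2) _.
by rewrite leq_eqVlt; apply/orP; left; apply/eqP; ring.
Qed.

(** Combines the bound for each slice, summed by concavity, with the trivial
    bound. *)
Lemma interaction_exp9_le :
  (\sum_z interaction z) ^+ 9 <= 2560 * N%:R ^+ 13 * q%:R ^+ 9.
Proof.
set J := \sum_z _.
have J0 : 0 <= J by apply: sumr_ge0 => z _; apply: interaction_ge0.
have J8 : J ^+ 8 <= 2560 * N%:R ^+ 11 * q%:R ^+ 9.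
  have -> : 2560 * N%:R ^+ 11 * q%:R ^+ 9
      = 2 ^+ 8 * (10 * N%:R ^+ 6 * q%:R ^+ 6) * q%:R ^+ 3 * N%:R ^+ 5 :> R.
    by ring.
  apply: (sum_le_of_exp8_le (m := fun z => #|slice E z|%:R)) => //.
  - exact: interaction_ge0.
  - by rewrite -natr_sum card_slices.
  - exact: interaction_exp8_le.
exact: (exp9_le_of_exp8_le J0 (ler0n _ _) (ler0n _ _)
  (exprn_ge0 _ (ler0n _ _)) interaction_le_card J8).
Qed.

(** The estimate T^9 <= C N^13, dual to the restricted weak-type bound at the
    exponent 18/5. *)
Lemma dual_restriction :
  (q%:R ^- 2 * \sum_xi normc (\sum_(x in E) th x * e (dotp x (lift xi))) ^+ 2)
    ^+ 9 <= 2 ^+ 9 * (1 + 2560) * N%:R ^+ 13.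
Proof.
have q0 : 0 < q%:R :> R by rewrite ltr0n; apply/card_gt0P; exists 0.
set T := _ * _; set J := \sum_z interaction z.
have J0 : 0 <= J by apply: sumr_ge0 => z _; apply: interaction_ge0.
have T0 : 0 <= T.
  by rewrite mulr_ge0 ?invr_ge0 ?exprn_ge0 ?sumr_ge0 // => xi _;
     rewrite exprn_ge0 ?normc_ge0.
pose K := J / q%:R; have K0 : 0 <= K by rewrite divr_ge0.
have TK : T <= N%:R + K.
  rewrite /T mulrC ler_pdivrMr ?exprn_gt0 //.
  apply: le_trans dual_sqr_le_interaction _; rewrite le_eqVlt; apply/orP; left.
  by apply/eqP; rewrite -/J /K; field; rewrite gt_eqF.
have K9 : K ^+ 9 <= 2560 * N%:R ^+ 13.
  by rewrite expr_div_n ler_pdivrMr ?exprn_gt0 // interaction_exp9_le.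
have N9 : N%:R ^+ 9 <= N%:R ^+ 13 :> R.
  by rewrite -!natrX ler_nat; case: #|E| => // n; rewrite leq_pexp2l.
(* (N + K)^9 <= (2 max (N, K))^9 *)
have NK9 : (N%:R + K) ^+ 9 <= 2 ^+ 9 * (N%:R ^+ 9 + K ^+ 9).
  rewrite mulrDr -!exprMn; have [le|/ltW le] := leP N%:R K.
    apply: (@le_trans _ _ ((2 * K) ^+ 9)); last first.
      by rewrite lerDr exprn_ge0 // mulr_ge0.
    by rewrite lerXn2r ?nnegrE ?addr_ge0 ?mulr_ge0 // mulr_natl mulr2n ?lerD2r ?lerD2l.
  apply: (@le_trans _ _ ((2 * N%:R) ^+ 9)); last first.
    by rewrite lerDl exprn_ge0 // mulr_ge0.
  by rewrite lerXn2r ?nnegrE ?addr_ge0 ?mulr_ge0 // mulr_natl mulr2n ?lerD2r ?lerD2l.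
have T9 : T ^+ 9 <= (N%:R + K) ^+ 9.
  by rewrite lerXn2r ?nnegrE ?addr_ge0.
apply: le_trans T9 (le_trans NK9 _).
rewrite -mulrA; apply: ler_wpM2l; first exact: exprn_ge0 (ler0n _ _).
by rewrite mulrDl mul1r; apply: lerD.
Qed.

End DualRestriction.

(** * The weak-type estimate *)

Section WeakType.
Variables (R : realType) (F : finFieldType) (e : F -> R[i]).
Hypothesis he : nonprincipal_character e.
Local Notation normc := Normc.normc.
Local Notation q := #|F|.

Lemma lift_paraboloid_inj (d : nat) : injective (@lift_paraboloid F d).
Proof. by move=> a b /eq_row_mx[]. Qed.

Lemma card_paraboloid (d : nat) : #|paraboloid F d| = (q ^ d)%N.
Proof. by rewrite (card_imset _ (@lift_paraboloid_inj d)) card_mx mul1n. Qed.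

Lemma sum_paraboloid (V : nmodType) (d : nat) (f : 'rV[F]_(d + 1) -> V) :
  \sum_(x in paraboloid F d) f x = \sum_xi f (lift_paraboloid xi).
Proof.
rewrite /paraboloid (big_imset f (h := @lift_paraboloid F d)) //=.
by move=> a b _ _; apply: lift_paraboloid_inj.
Qed.

Variable g : 'rV[F]_(2 + 1) -> R[i].
Hypothesis aniso : anisotropic F 2.
Local Notation lift := (@lift_paraboloid F 2).
Local Notation S := (paraboloid F 2).

(** The square of the L^2 norm of g for the normalized measure on the
    paraboloid. *)
Definition mean_sqr : R := q%:R ^- 2 * \sum_xi normc (g (lift xi)) ^+ 2.

(** With th the conjugate phase of the extension, the sum of its modulus over the
    level set E is the pairing of g with the Fourier transform of th on E, so
    that Cauchy-Schwarz bounds l #|E| by the product of two L^2 norms; take the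
    eighteenth power and divide by #|E|^13. *)
Lemma extension_weak_type (l : R) : 0 <= l ->
  l ^+ 18 * #|[set x | l < normc (extension e S g x)]%SET|%:R ^+ 5
    <= 2 ^+ 9 * (1 + 2560) * mean_sqr ^+ 9.
Proof.
move=> l0; set E := [set _ | _]%SET; pose u x := normc (extension e S g x).
have q2 : 0 <= q%:R ^- 2 :> R by rewrite invr_ge0 exprn_ge0.
have B0 : 0 <= mean_sqr.
  by rewrite mulr_ge0 // sumr_ge0 // => xi _; rewrite exprn_ge0 ?normc_ge0.
have k0 : 0 <= 2 ^+ 9 * (1 + 2560) :> R.
  exact: mulr_ge0 (exprn_ge0 _ (ler0n _ _)) (addr_ge0 ler01 (ler0n _ _)).
(* Where u x = 0 the convention 0^-1 = 0 gives th x = 0. *)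
pose th x : R[i] := conjc (extension e S g x) * real_complex R (u x)^-1.
have th1 x : normc (th x) <= 1.
  rewrite Normc.normcM normc_conj normc_real ger0_norm ?invr_ge0 ?normc_ge0 //.
  have [->|u0] := eqVneq (u x) 0; first by rewrite invr0 mulr0.
  by rewrite divff.
have thu x : th x * extension e S g x = real_complex R (u x).
  rewrite /th mulrAC (mulrC (conjc _)) -sqr_normc -rmorphM /= -/(u x).
  have [->|u0] := eqVneq (u x) 0; first by rewrite invr0 mulr0.
  by rewrite expr2 mulfK.
pose Th xi := \sum_(x in E) th x * e (dotp x (lift xi)).
have dual := dual_restriction he aniso E th1.
set T := (X in X ^+ 9) in dual.
have T0 : 0 <= T.
  by rewrite mulr_ge0 // sumr_ge0 // => xi _; rewrite exprn_ge0 ?normc_ge0.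
have sumE : real_complex R (\sum_(x in E) u x)
    = real_complex R (q%:R ^- 2) * \sum_xi g (lift xi) * Th xi.
  rewrite rmorph_sum /=; under eq_bigr do rewrite -thu /extension sum_paraboloid.
  rewrite /Th mulr_sumr; under [RHS]eq_bigr do rewrite !mulr_sumr.
  rewrite [RHS]exchange_big /=; apply: eq_bigr => x _.
  rewrite !mulr_sumr; apply: eq_bigr => xi _.
  rewrite card_paraboloid fmorphV rmorphXn /= rmorph_nat -natrX.
  by ring.
have lE : l * #|E|%:R <= q%:R ^- 2 * \sum_xi normc (g (lift xi)) * normc (Th xi).
  apply: (@le_trans _ _ (\sum_(x in E) u x)).
    rewrite -sum1_card natr_sum mulr_sumr; apply: ler_sum => x.
    by rewrite inE mulr1 => /ltW.
  have s0 : 0 <= \sum_(x in E) u x by apply: sumr_ge0 => x _; apply: normc_ge0.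
  rewrite -(ger0_norm s0) -normc_real sumE Normc.normcM normc_real ger0_norm //.
  rewrite ler_wpM2l //; apply: le_trans (le_normc_sum _ _ _) _.
  by apply: ler_sum => xi _; rewrite Normc.normcM.
have lE2 : (l * #|E|%:R) ^+ 2 <= mean_sqr * T.
  apply: (@le_trans _ _
    ((q%:R ^- 2 * \sum_xi normc (g (lift xi)) * normc (Th xi)) ^+ 2)).
    rewrite lerXn2r ?nnegrE ?mulr_ge0 ?sumr_ge0 // => xi _.
    by rewrite mulr_ge0 ?normc_ge0.
  rewrite exprMn /mean_sqr /T [leRHS]mulrACA -expr2 ler_wpM2l ?exprn_ge0 //.
  exact: cauchy_schwarz_sum.
have lE18 : (l * #|E|%:R) ^+ 18 <= mean_sqr ^+ 9 * T ^+ 9.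
  rewrite -exprMn (exprM _ 2 9) lerXn2r ?nnegrE ?(mulr_ge0 B0 T0) //.
  by rewrite exprn_ge0 ?mulr_ge0.
move: dual lE18; move: (2 ^+ 9 * (1 + 2560) : R) k0 => k k0 dual lE18.
have [->|n0] := posnP #|E|.
  by rewrite expr0n mulr0 mulr_ge0 ?exprn_ge0.
have n13 : 0 < #|E|%:R ^+ 13 :> R by rewrite exprn_gt0 ?ltr0n.
rewrite -(ler_pM2r n13) -mulrA -exprD -exprMn; apply: le_trans lE18 _.
by rewrite -[leRHS]mulrA [leRHS]mulrCA ler_wpM2l ?exprn_ge0.
Qed.

End WeakType.

(** * From weak type to strong type *)

Section WeakToStrong.
Variable R : realType.
Implicit Types (u : R).

Lemma dyadic_scale u : 0 < u <= 1 -> exists k, 2 ^- k.+1 < u <= 2 ^- k.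
Proof.
move=> /andP[u0 u1].
have ex : exists n, 2 ^- n < u.
  exists (Num.bound u^-1); rewrite -ltf_pV2 ?posrE ?invr_gt0 ?exprn_gt0 //.
  by rewrite invrK; apply: upper_nthrootP.
case: (ex_minnP ex) => -[|k] kP kmin.
  by move: kP; rewrite expr0 invr1 ltNge u1.
exists k; rewrite kP leNgt; apply/negP => /kmin.
by rewrite ltnn.
Qed.

Lemma geometric_sum_le (th : R) n : 0 <= th < 1 ->
  \sum_(k < n) th ^+ k <= (1 - th)^-1.
Proof.
move=> /andP[th0 th1]; have d0 : 0 < 1 - th by rewrite subr_gt0.
rewrite -[leRHS]mul1r ler_pdivlMr // mulrC -opprB mulNr -subrX1 opprB.
by rewrite lerBlDr lerDl exprn_ge0.
Qed.

(** Layer-cake over dyadic levels: the points with w between 2^-(m+1) and 2^-m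
    number at most 2^(r (m+1)), so that their contribution is at most
    2^r (2^(r-p))^m. *)
Lemma sum_powR_le (T : finType) (w : T -> R) (r p : R) :
  0 < r -> r < p -> (forall x, 0 <= w x <= 1) ->
  (forall l, 0 < l -> #|[set x | l < w x]%SET|%:R <= (l^-1) `^ r) ->
  \sum_x w x `^ p <= 2 `^ r / (1 - 2 `^ (r - p)).
Proof.
move=> r0 rp w01 wk.
have scale x : exists k, 0 < w x -> 2 ^- k.+1 < w x <= 2 ^- k.
  have [w0|] := ltP 0 (w x); last by exists 0%N.
  by have [|k kP] := @dyadic_scale (w x); [case/andP: (w01 x) => _ ->; rewrite w0|
     exists k].
have [k kP] := boolp.choice scale.
pose M := (\max_x k x).+1; pose sg : R := 2 `^ (- p).
have sg0 : 0 <= sg by apply: powR_ge0.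
have powE (m : nat) : (2 ^- m) `^ p = sg ^+ m.
  by rewrite -powR_invn // powRAC powR_invn ?powR_ge0 // /sg powRN exprVn.
have p0 : 0 < p by apply: lt_trans rp.
apply: (@le_trans _ _ (\sum_x \sum_(m < M) sg ^+ m * (2 ^- m.+1 < w x)%R%:R)).
  apply: ler_sum => x _; have [w0|] := ltP 0 (w x); last first.
    case/andP: (w01 x) => w0 _ w0'.
    have -> : w x = 0 by apply/eqP; rewrite eq_le w0 w0'.
    rewrite powR0 ?gt_eqF //; apply: sumr_ge0 => m _.
    by rewrite mulr_ge0 ?exprn_ge0.
  have kM : (k x < M)%N by rewrite ltnS; apply: leq_bigmax.
  have /andP[k1 k2] := kP x w0.
  rewrite (bigD1 (Ordinal kM)) //= k1 mulr1.
  apply: (@le_trans _ _ (sg ^+ k x)).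
    by rewrite -powE ge0_ler_powR ?nnegrE ?invr_ge0 ?exprn_ge0 // ltW.
  by rewrite lerDl sumr_ge0 // => m _; rewrite mulr_ge0 ?exprn_ge0.
rewrite exchange_big /=.
apply: (@le_trans _ _ (\sum_(m < M) 2 `^ r * (2 `^ (r - p)) ^+ m)).
  apply: ler_sum => m _; rewrite -mulr_sumr.
  have -> : \sum_x (2 ^- m.+1 < w x)%R%:R = #|[set x | 2 ^- m.+1 < w x]%SET|%:R :> R.
    rewrite -sum1_card natr_sum [RHS]big_mkcond /=.
    by apply: eq_bigr => x _; rewrite inE; case: (_ < _).
  apply: (@le_trans _ _ (sg ^+ m * (2 `^ r) ^+ m.+1)).
    rewrite ler_wpM2l ?exprn_ge0 //; apply: le_trans (wk _ _) _.
      by rewrite invr_gt0 exprn_gt0.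
    by rewrite invrK -powR_mulrn // powRAC powR_mulrn ?powR_ge0.
  rewrite powRB ?pnatr_eq0 ?implybT // -powRN -/sg.
  by rewrite exprS exprMn mulrCA (mulrC (sg ^+ m)).
rewrite -mulr_sumr ler_wpM2l ?powR_ge0 // geometric_sum_le // powR_ge0 /=.
have : 1 `^ (p - r) < 2 `^ (p - r).
  by apply: gt0_ltr_powR; rewrite ?subr_gt0 ?nnegrE ?ltr1n.
by rewrite powR1 -(opprB p r) powRN invf_lt1 ?powR_gt0.
Qed.

(** The weak bound itself shows u <= k B, since a nonempty level set has at least
    one point; dividing by k B reduces to a function with values in [0, 1] whose
    level sets obey a weak bound with constant 1. *)
Lemma strong_of_weak (eps k : R) : 0 < eps -> 1 < k ->
  exists C, forall (T : finType) (u : T -> R) (B : R),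
    0 <= B -> (forall x, 0 <= u x) ->
    (forall l, 0 <= l -> l ^+ 18 * #|[set x | l < u x]%SET|%:R ^+ 5
       <= k * B ^+ 18) ->
    (\sum_x u x `^ (18 / 5 + eps)) `^ (18 / 5 + eps)^-1 <= C * B.
Proof.
move=> eps0 k1; have k0 : 0 < k by apply: lt_trans k1.
pose r : R := 18 / 5; rewrite -/r; set p := r + eps.
have r0 : 0 < r by rewrite divr_gt0.
have rp : r < p by rewrite ltrDl.
have p0 : 0 < p by apply: lt_trans rp.
pose C0 : R := 2 `^ r / (1 - 2 `^ (r - p)).
exists (k * C0 `^ p^-1) => T u B B0 u0 weak.
have card1 l x : l < u x -> 1 <= #|[set y | l < u y]%SET|%:R ^+ 5 :> R.
  by move=> lu; rewrite exprn_ege1 // ler1n; apply/card_gt0P; exists x; rewrite inE.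
pose D := k * B.
have uD x : u x <= D.
  rewrite leNgt; apply/negP => Du.
  have D0 : 0 <= D by rewrite mulr_ge0 // ltW.
  (* For B = 0 the level D is 0, and the weak bound is used at u x / 2. *)
  have [B00|Bn0] := eqVneq B 0.
    have ux0 : 0 < u x by apply: le_lt_trans Du.
    have lt2 : u x / 2 < u x by rewrite ltr_pdivrMr // ltr_pMr // ltr1n.
    have := weak (u x / 2); rewrite divr_ge0 // B00 expr0n mulr0 => /(_ isT).
    rewrite leNgt => /negP; apply; apply: mulr_gt0.
      by rewrite exprn_gt0 ?divr_gt0.
    exact: lt_le_trans ltr01 (card1 _ _ lt2).
  have Bp : 0 < B ^+ 18 by rewrite exprn_gt0 // lt_def Bn0.
  have := weak D D0; rewrite leNgt => /negP; apply.
  apply: (@lt_le_trans _ _ (D ^+ 18)); last first.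
    by rewrite ler_peMr ?exprn_ge0 // (card1 _ _ Du).
  by rewrite exprMn ltr_pM2r // exprS ltr_pMr // exprn_egt1.
have [B00|Bn0] := eqVneq B 0.
  rewrite big1 => [|x _]; first by rewrite powR0 ?invr_eq0 ?gt_eqF // B00 mulr0.
  have -> : u x = 0.
    by apply/eqP; rewrite eq_le u0 andbT; have := uD x; rewrite /D B00 mulr0.
  by rewrite powR0 ?gt_eqF.
have D0 : 0 < D by rewrite mulr_gt0 // lt_def Bn0.
pose w x := u x / D.
have sumw : \sum_x w x `^ p <= C0.
  apply: sum_powR_le => // [x|l l0].
    by rewrite divr_ge0 ?(ltW D0) //= ler_pdivrMr // mul1r.
  have -> : [set x | l < w x]%SET = [set x | l * D < u x]%SET.
    by apply/setP => x; rewrite !inE ltr_pdivlMr.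
  have := weak (l * D) (mulr_ge0 (ltW l0) (ltW D0)).
  set n := #|_|%:R => wk.
  rewrite -(ler_pXn2r (n := 5)) ?nnegrE ?powR_ge0 //.
  have -> : (l^-1 `^ r) ^+ 5 = l^-1 ^+ 18.
    have l10 : 0 <= l^-1 by rewrite invr_ge0 ltW.
    by rewrite -powR_mulrn ?powR_ge0 // -powRrM divfK // powR_mulrn.
  rewrite exprVn -[leRHS]mul1r ler_pdivlMr ?exprn_gt0 // mulrC.
  rewrite -(ler_pM2r (exprn_gt0 18 D0)) mul1r mulrAC -exprMn.
  apply: le_trans wk _; rewrite exprMn ler_wpM2r ?exprn_ge0 //.
  by rewrite exprS ler_peMr ?(ltW k0) // exprn_ege1 // ltW.
have -> : \sum_x u x `^ p = D `^ p * \sum_x w x `^ p.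
  rewrite mulr_sumr; apply: eq_bigr => x _.
  rewrite -powRM ?(ltW D0) ?divr_ge0 ?(ltW D0) //.
  by rewrite /w mulrC divfK // gt_eqF.
have s0 : 0 <= \sum_x w x `^ p by apply: sumr_ge0 => x _; apply: powR_ge0.
rewrite powRM ?powR_ge0 // -powRrM divff ?gt_eqF // powRr1 ?(ltW D0) //.
rewrite [leRHS]mulrAC ler_wpM2l ?(ltW D0) //.
rewrite ge0_ler_powR ?nnegrE ?invr_ge0 ?(ltW p0) //.
exact: le_trans sumw.
Qed.

End WeakToStrong.

Theorem theorem6p2 (R : realType) (eps : R) (heps : 0 < eps) :
  exists C : R,
    forall (F : finFieldType) (p : nat) (e : F -> R[i]),
      p \in [pchar F] -> (2 < p)%N ->
      ~ (exists x : F, x ^+ 2 = -1) ->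
      nonprincipal_character e ->
      (@Rstar R F 3 e (paraboloid F 2) 2%:E (18%:R / 5%:R + eps)%:E
         <= C%:E)%E.
Proof.
have k1 : 1 < 2 ^+ 9 * (1 + 2560) :> R.
  apply: (@lt_le_trans _ _ (2 ^+ 9)); first by rewrite exprn_egt1 // ltr1n.
  by rewrite ler_peMr ?exprn_ge0 // lerDl ler0n.
have [C CP] := strong_of_weak heps k1; exists C => F p e _ _ nsq he.
apply: ereal_inf_lbound; exists C => //= g.
have aniso := anisotropic2 nsq.
have B0 : 0 <= mean_sqr g.
  by rewrite mulr_ge0 ?invr_ge0 ?exprn_ge0 ?sumr_ge0 // => xi _;
     rewrite exprn_ge0 ?normc_ge0.
suff : Lnorm_dx (18%:R / 5%:R + eps)%:E (extension e (paraboloid F 2) g)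
    <= C * Lnorm_dsigma (paraboloid F 2) 2%:E g by [].
have -> : Lnorm_dsigma (paraboloid F 2) 2%:E g = Num.sqrt (mean_sqr g).
  rewrite /Lnorm_dsigma /Lnorm_fin powR12_sqrt; last first.
    apply: sumr_ge0 => x _.
    by rewrite mulr_ge0 ?invr_ge0 ?powR_ge0.
  rewrite sum_paraboloid card_paraboloid /mean_sqr natrX mulr_sumr.
  congr Num.sqrt; apply: eq_bigr => xi _.
  by rewrite powR_mulrn ?normc_ge0.
rewrite /Lnorm_dx /Lnorm_fin; under eq_bigl do rewrite inE.
under eq_bigr do rewrite mul1r.
apply: CP => [||l l0]; [exact: sqrtr_ge0|move=> x; exact: normc_ge0|].
rewrite (exprM (Num.sqrt _) 2 9) sqr_sqrtr //.
exact: extension_weak_type.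
Qed.
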